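(* Let $g\in A_1^{\mathfrak{sl}(2)}$ be the realisation of $\mathfrak{sl}(2)$ in $A_1$ given by $$g(e_+)=(1+pq)q,\qquad g(e_-)=-p+4p^2q^3-4p^3q^6+12p^2q^5,\qquad g(e_0)=2pq-4p^2q^4+1.$$ Then $g\notin\mathcal D$; that is, there is no $(\alpha,w)\in\mathrm{Aut}(A_1)\times\mathrm{Aut}(\mathfrak{sl}(2))$ with $(\alpha,w)\cdot g\in\mathcal N$.
   Context: The Weyl algebra $A_1$ is the complex associative unital algebra generated by $p,q$ with $pq-qp=1$, with Lie bracket $[a,b]=ab-ba$. $A_1^{\mathfrak{sl}(2)}$ is the set of injective Lie algebra homomorphisms $\mathfrak{sl}(2)=\mathfrak{sl}(2,\mathbb C)\to A_1$. The group $\mathrm{Aut}(A_1)\times\mathrm{Aut}(\mathfrak{sl}(2))$ acts on it by $(\alpha,w)\cdot f=\alpha\circ f\circ w^{-1}$. Let $e_+=\begin{pmatrix}0&1\\0&0\end{pmatrix}$, $e_-=\begin{pmatrix}0&0\\1&0\end{pmatrix}$, $e_0=\begin{pmatrix}1&0\\0&-1\end{pmatrix}$. The elements $f_I,f_{II}^b\in A_1^{\mathfrak{sl}(2)}$ ($b\in\mathbb C$) are defined by $f_I(e_+)=-\frac12q^2$, $f_I(e_-)=\frac12p^2$, $f_I(e_0)=\frac12(pq+qp)$; $f_{II}^b(e_+)=(b+pq)q$, $f_{II}^b(e_-)=-p$, $f_{II}^b(e_0)=2pq+b$. Put $\mathcal N=\{f_I\}\cup\{f_{II}^b:b\in\mathbb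 C\}$ and $\mathcal D=\{f\in A_1^{\mathfrak{sl}(2)}:\exists(\alpha,w)\in\mathrm{Aut}(A_1)\times\mathrm{Aut}(\mathfrak{sl}(2))\text{ with }(\alpha,w)\cdot f\in\mathcal N\}$. The realisation $g$ equals $\hat f_{II}^{1}\circ w|_{\mathfrak{sl}(2)}$, where $\hat f_{II}^1:\mathcal U(\mathfrak{sl}(2))\to A_1$ is the extension of $f_{II}^1$ to the universal enveloping algebra and $w=\exp(\mathrm{ad}(x^2))\in\mathrm{Aut}(\mathcal U(\mathfrak{sl}(2)))$, $x$ being the image of $e_+$ in $\mathcal U(\mathfrak{sl}(2))$. *)

(* Defs.v *)
From HB Require Import structures.
From mathcomp Require Import all_boot all_order all_algebra.
From mathcomp Require Import boolp classical_sets reals complex.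
From mathcomp Require Import ring.

Set Implicit Arguments.
Unset Strict Implicit.
Unset Printing Implicit Defensive.

Import Order.TTheory GRing.Theory Num.Theory.
Local Open Scope quotient_scope.
Local Open Scope ring_scope.

(* The Weyl algebra K<p, q | p q - q p = 1>: algebra expressions in the two
   generators modulo the smallest congruence that contains the axioms of unital
   associative K-algebras and the relation p q - q p = 1. *)

Inductive wterm (K : Type) : Type :=
| wP | wQ | wZero | wOne
| wAdd of wterm K & wterm K
| wOpp of wterm K
| wMul of wterm K & wterm K
| wScale of K & wterm K.

Arguments wP {K}.
Arguments wQ {K}.
Arguments wZero {K}.
Arguments wOne {K}.

Inductive weq (K : fieldType) : wterm K -> wterm K -> Prop :=
| weq_refl s : weq s s
| weq_sym s t : weq s t -> weq t s
| weq_trans s t u : weq s t -> weq t u -> weq s u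
| weq_add s s' t t' : weq s s' -> weq t t' -> weq (wAdd s t) (wAdd s' t')
| weq_opp s s' : weq s s' -> weq (wOpp s) (wOpp s')
| weq_mul s s' t t' : weq s s' -> weq t t' -> weq (wMul s t) (wMul s' t')
| weq_scale c s s' : weq s s' -> weq (wScale c s) (wScale c s')
| weq_addA s t u : weq (wAdd s (wAdd t u)) (wAdd (wAdd s t) u)
| weq_addC s t : weq (wAdd s t) (wAdd t s)
| weq_add0 s : weq (wAdd wZero s) s
| weq_addN s : weq (wAdd (wOpp s) s) wZero
| weq_mulA s t u : weq (wMul s (wMul t u)) (wMul (wMul s t) u)
| weq_mul1l s : weq (wMul wOne s) s
| weq_mul1r s : weq (wMul s wOne) s
| weq_mulDl s t u : weq (wMul (wAdd s t) u) (wAdd (wMul s u) (wMul t u))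
| weq_mulDr s t u : weq (wMul s (wAdd t u)) (wAdd (wMul s t) (wMul s u))
| weq_scaleA c d s : weq (wScale c (wScale d s)) (wScale (c * d) s)
| weq_scale1 s : weq (wScale 1 s) s
| weq_scaleDr c s t : weq (wScale c (wAdd s t)) (wAdd (wScale c s) (wScale c t))
| weq_scaleDl s c d : weq (wScale (c + d) s) (wAdd (wScale c s) (wScale d s))
| weq_scaleAl c s t : weq (wScale c (wMul s t)) (wMul (wScale c s) t)
| weq_scaleAr c s t : weq (wScale c (wMul s t)) (wMul s (wScale c t))
| weq_pq : weq (wAdd (wMul wP wQ) (wOpp (wMul wQ wP))) wOne.

HB.instance Definition _ (K : Type) := gen_eqMixin (wterm K).
HB.instance Definition _ (K : Type) := gen_choiceMixin (wterm K).

Definition weqb (K : fieldType) : rel (wterm K) := fun s t => `[< weq s t >].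

Lemma weqb_refl (K : fieldType) : reflexive (@weqb K).
Proof. by move=> s; apply/asboolP/weq_refl. Qed.

Lemma weqb_sym (K : fieldType) : symmetric (@weqb K).
Proof. by move=> s t; apply/asboolP/asboolP; apply: weq_sym. Qed.

Lemma weqb_trans (K : fieldType) : transitive (@weqb K).
Proof.
by move=> t s u /asboolP st /asboolP tu; apply/asboolP/(weq_trans st tu).
Qed.

Canonical weqb_equiv (K : fieldType) :=
  EquivRel (@weqb K) (@weqb_refl K) (@weqb_sym K) (@weqb_trans K).

Definition weyl (K : fieldType) : Type := {eq_quot @weqb_equiv K}.

HB.instance Definition _ (K : fieldType) := Choice.on (weyl K).
HB.instance Definition _ (K : fieldType) := EqQuotient.on (weyl K).

Section WeylAlgebra.
Variable K : fieldType.
Local Notation W := (weyl K).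
Implicit Types (s t : wterm K) (a b c : W).

Definition wpi s : W := \pi s.

Lemma wpiP s t : wpi s = wpi t <-> weq s t.
Proof. by split=> [/eqmodP/asboolP|st] //; apply/eqmodP/asboolP. Qed.

Lemma wpiK a : wpi (repr a) = a. Proof. exact: reprK. Qed.

Lemma weq_repr s : weq (repr (wpi s)) s.
Proof. by apply/wpiP; rewrite wpiK. Qed.

Lemma weylW (P : W -> Prop) : (forall s, P (wpi s)) -> forall a, P a.
Proof. by move=> Ps a; rewrite -[a]wpiK. Qed.

Definition weyl_add a b := wpi (wAdd (repr a) (repr b)).
Definition weyl_opp a := wpi (wOpp (repr a)).
Definition weyl_mul a b := wpi (wMul (repr a) (repr b)).
Definition weyl_scale (k : K) a := wpi (wScale k (repr a)).

Lemma wpi_add s t : weyl_add (wpi s) (wpi t) = wpi (wAdd s t).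
Proof. by apply/wpiP/weq_add; apply: weq_repr. Qed.
Lemma wpi_opp s : weyl_opp (wpi s) = wpi (wOpp s).
Proof. by apply/wpiP/weq_opp/weq_repr. Qed.
Lemma wpi_mul s t : weyl_mul (wpi s) (wpi t) = wpi (wMul s t).
Proof. by apply/wpiP/weq_mul; apply: weq_repr. Qed.
Lemma wpi_scale k s : weyl_scale k (wpi s) = wpi (wScale k s).
Proof. by apply/wpiP/weq_scale/weq_repr. Qed.

Let wpiE := (wpi_add, wpi_opp, wpi_mul, wpi_scale).

Fact weyl_addA : associative weyl_add.
Proof.
by elim/weylW=> s; elim/weylW=> t; elim/weylW=> u; rewrite !wpiE; apply/wpiP/weq_addA.
Qed.
Fact weyl_addC : commutative weyl_add.
Proof. by elim/weylW=> s; elim/weylW=> t; rewrite !wpiE; apply/wpiP/weq_addC. Qed.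
Fact weyl_add0 : left_id (wpi wZero) weyl_add.
Proof. by elim/weylW=> s; rewrite !wpiE; apply/wpiP/weq_add0. Qed.
Fact weyl_addN : left_inverse (wpi wZero) weyl_opp weyl_add.
Proof. by elim/weylW=> s; rewrite !wpiE; apply/wpiP/weq_addN. Qed.

HB.instance Definition _ :=
  GRing.isZmodule.Build W weyl_addA weyl_addC weyl_add0 weyl_addN.

Lemma wpiD s t : wpi s + wpi t = wpi (wAdd s t). Proof. exact: wpi_add. Qed.
Lemma wpiN s : - wpi s = wpi (wOpp s). Proof. exact: wpi_opp. Qed.

(* The action on polynomials with p = d/dX and q = multiplication by 'X shows
   that the quotient is not the zero ring. *)
Fixpoint wact s (f : {poly K}) : {poly K} :=
  match s with
  | wP => f^`()
  | wQ => 'X * f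
  | wZero => 0
  | wOne => f
  | wAdd s t => wact s f + wact t f
  | wOpp s => - wact s f
  | wMul s t => wact s (wact t f)
  | wScale k s => k *: wact s f
  end.

Lemma wactD s f g : wact s (f + g) = wact s f + wact s g.
Proof.
elim: s f g => //= [|||s IHs t IHt|s IHs|s IHs t IHt|k s IHs] f g.
- by rewrite derivD.
- by rewrite mulrDr.
- by rewrite addr0.
- by rewrite IHs IHt addrACA.
- by rewrite IHs opprD.
- by rewrite IHt IHs.
- by rewrite IHs scalerDr.
Qed.

Lemma wactZ s k f : wact s (k *: f) = k *: wact s f.
Proof.
elim: s k f => //= [|||s IHs t IHt|s IHs|s IHs t IHt|l s IHs] k f.
- by rewrite derivZ.
- by rewrite scalerAr.
- by rewrite scaler0.
- by rewrite IHs IHt scalerDr.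
- by rewrite IHs scalerN.
- by rewrite IHt IHs.
- by rewrite IHs !scalerA mulrC.
Qed.

Lemma wact_weq s t : weq s t -> wact s =1 wact t.
Proof.
elim=> {s t} //=.
- by move=> s t _ IH f; rewrite IH.
- by move=> s t u _ IH1 _ IH2 f; rewrite IH1.
- by move=> s s' t t' _ IHs _ IHt f; rewrite IHs IHt.
- by move=> s s' _ IHs f; rewrite IHs.
- by move=> s s' t t' _ IHs _ IHt f; rewrite IHs IHt.
- by move=> c s s' _ IHs f; rewrite IHs.
- by move=> s t u f; rewrite addrA.
- by move=> s t f; rewrite addrC.
- by move=> s f; rewrite add0r.
- by move=> s f; rewrite addNr.
- by move=> s t u f; rewrite wactD.
- by move=> c d s f; rewrite scalerA.
- by move=> s f; rewrite scale1r.
- by move=> c s t f; rewrite scalerDr.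
- by move=> s c d f; rewrite scalerDl.
- by move=> c s t f; rewrite wactZ.
- by move=> f; rewrite derivM derivX mul1r addrK.
Qed.

Definition weyl_act a : {poly K} -> {poly K} := wact (repr a).

Lemma weyl_act_pi s : weyl_act (wpi s) =1 wact s.
Proof. exact/wact_weq/weq_repr. Qed.

Fact weyl_mulA : associative weyl_mul.
Proof.
by elim/weylW=> s; elim/weylW=> t; elim/weylW=> u; rewrite !wpiE; apply/wpiP/weq_mulA.
Qed.
Fact weyl_mul1l : left_id (wpi wOne) weyl_mul.
Proof. by elim/weylW=> s; rewrite !wpiE; apply/wpiP/weq_mul1l. Qed.
Fact weyl_mul1r : right_id (wpi wOne) weyl_mul.
Proof. by elim/weylW=> s; rewrite !wpiE; apply/wpiP/weq_mul1r. Qed.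
Fact weyl_mulDl : left_distributive weyl_mul weyl_add.
Proof.
by elim/weylW=> s; elim/weylW=> t; elim/weylW=> u; rewrite !wpiE; apply/wpiP/weq_mulDl.
Qed.
Fact weyl_mulDr : right_distributive weyl_mul weyl_add.
Proof.
by elim/weylW=> s; elim/weylW=> t; elim/weylW=> u; rewrite !wpiE; apply/wpiP/weq_mulDr.
Qed.
Fact weyl_one_neq0 : wpi wOne != 0.
Proof.
apply/eqP=> /wpiP/wact_weq/(_ 1)/= /eqP; exact/negP/oner_neq0.
Qed.

HB.instance Definition _ := GRing.Zmodule_isNzRing.Build W
  weyl_mulA weyl_mul1l weyl_mul1r weyl_mulDl weyl_mulDr weyl_one_neq0.

Lemma wpiM s t : wpi s * wpi t = wpi (wMul s t). Proof. exact: wpi_mul. Qed.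

Fact weyl_scaleA k l a : weyl_scale k (weyl_scale l a) = weyl_scale (k * l) a.
Proof. by elim/weylW: a => s; rewrite !wpiE; apply/wpiP/weq_scaleA. Qed.
Fact weyl_scale1 : left_id 1 weyl_scale.
Proof. by elim/weylW=> s; rewrite !wpiE; apply/wpiP/weq_scale1. Qed.
Fact weyl_scaleDr : right_distributive weyl_scale +%R.
Proof.
move=> k; elim/weylW=> s; elim/weylW=> t.
by rewrite wpiD !wpi_scale wpiD; apply/wpiP/weq_scaleDr.
Qed.
Fact weyl_scaleDl a : {morph weyl_scale^~ a : k l / k + l}.
Proof.
move=> k l; elim/weylW: a => s /=; rewrite !wpi_scale wpiD; exact/wpiP/weq_scaleDl.
Qed.

HB.instance Definition _ := GRing.Zmodule_isLmodule.Build K W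
  weyl_scaleA weyl_scale1 weyl_scaleDr weyl_scaleDl.

Lemma wpiZ k s : k *: wpi s = wpi (wScale k s). Proof. exact: wpi_scale. Qed.

Fact weyl_scaleAl k a b : k *: (a * b) = k *: a * b.
Proof.
elim/weylW: a => s; elim/weylW: b => t.
by rewrite wpiM !wpiZ wpiM; apply/wpiP/weq_scaleAl.
Qed.

HB.instance Definition _ := GRing.Lmodule_isLalgebra.Build K W weyl_scaleAl.

Fact weyl_scaleAr k a b : k *: (a * b) = a * (k *: b).
Proof.
elim/weylW: a => s; elim/weylW: b => t.
by rewrite wpiM !wpiZ wpiM; apply/wpiP/weq_scaleAr.
Qed.

HB.instance Definition _ := GRing.Lalgebra_isAlgebra.Build K W weyl_scaleAr.

Definition weyl_p : W := wpi wP.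
Definition weyl_q : W := wpi wQ.

Lemma weyl_rel : weyl_p * weyl_q - weyl_q * weyl_p = 1.
Proof. by rewrite !wpiM wpiN wpiD; apply/wpiP/weq_pq. Qed.

Lemma weyl_actD a b f : weyl_act (a + b) f = weyl_act a f + weyl_act b f.
Proof.
by elim/weylW: a => s; elim/weylW: b => t; rewrite wpiD !weyl_act_pi.
Qed.
Lemma weyl_actM a b f : weyl_act (a * b) f = weyl_act a (weyl_act b f).
Proof.
by elim/weylW: a => s; elim/weylW: b => t; rewrite wpiM !weyl_act_pi.
Qed.
Lemma weyl_actZ k a f : weyl_act (k *: a) f = k *: weyl_act a f.
Proof. by elim/weylW: a => s; rewrite wpiZ !weyl_act_pi. Qed.
Lemma weyl_act0 f : weyl_act 0 f = 0. Proof. exact: (weyl_act_pi wZero). Qed.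
Lemma weyl_act1 f : weyl_act 1 f = f. Proof. exact: (weyl_act_pi wOne). Qed.
Lemma weyl_act_p f : weyl_act weyl_p f = f^`(). Proof. exact: weyl_act_pi. Qed.
Lemma weyl_act_q f : weyl_act weyl_q f = 'X * f. Proof. exact: weyl_act_pi. Qed.

Definition weyl_actE :=
  (weyl_actD, weyl_actM, weyl_actZ, weyl_act0, weyl_act1, weyl_act_p, weyl_act_q).

End WeylAlgebra.

Arguments weyl_p {K}.
Arguments weyl_q {K}.

Section UniversalProperty.
Variables (K : fieldType) (B : algType K) (x y : B).
Hypothesis xy : x * y - y * x = 1.

Fixpoint weval (s : wterm K) : B :=
  match s with
  | wP => x
  | wQ => y
  | wZero => 0
  | wOne => 1
  | wAdd s t => weval s + weval t
  | wOpp s => - weval s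
  | wMul s t => weval s * weval t
  | wScale k s => k *: weval s
  end.

Lemma weval_weq s t : weq s t -> weval s = weval t.
Proof.
elim=> {s t} //=; do ?by move=> *; congruence.
- by move=> *; rewrite addrA.
- by move=> *; rewrite addrC.
- by move=> *; rewrite add0r.
- by move=> *; rewrite addNr.
- by move=> *; rewrite mulrA.
- by move=> *; rewrite mul1r.
- by move=> *; rewrite mulr1.
- by move=> *; rewrite mulrDl.
- by move=> *; rewrite mulrDr.
- by move=> *; rewrite scalerA.
- by move=> *; rewrite scale1r.
- by move=> *; rewrite scalerDr.
- by move=> *; rewrite scalerDl.
- by move=> *; rewrite scalerAl.
- by move=> *; rewrite scalerAr.
Qed.

Definition weyl_eval (a : weyl K) : B := weval (repr a).

Lemma weyl_eval_pi s : weyl_eval (wpi s) = weval s.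
Proof. exact/weval_weq/weq_repr. Qed.

Fact weyl_eval_monoid : monoid_morphism weyl_eval.
Proof.
split=> [|a b]; first exact: (weyl_eval_pi wOne).
by elim/weylW: a => s; elim/weylW: b => t; rewrite wpiM !weyl_eval_pi.
Qed.

Fact weyl_eval_linear : linear weyl_eval.
Proof.
move=> k a b; elim/weylW: a => s; elim/weylW: b => t.
by rewrite wpiZ wpiD !weyl_eval_pi.
Qed.

HB.instance Definition _ :=
  GRing.isLinear.Build K (weyl K) B *:%R weyl_eval weyl_eval_linear.
HB.instance Definition _ :=
  GRing.isMonoidMorphism.Build (weyl K) B weyl_eval weyl_eval_monoid.

Theorem weyl_universal :
  exists2 f : {lrmorphism weyl K -> B}, f weyl_p = x /\ f weyl_q = y &
    forall h : {lrmorphism weyl K -> B}, h weyl_p = x -> h weyl_q = y -> h =1 f.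
Proof.
exists weyl_eval; first by split; apply: weyl_eval_pi.
move=> h hx hy; elim/weylW=> s; rewrite [RHS]weyl_eval_pi.
elim: s => [||||s IHs t IHt|s IHs|s IHs t IHt|k s IHs] //=.
- exact: raddf0.
- exact: rmorph1.
- by rewrite -wpiD raddfD /= IHs IHt.
- by rewrite -wpiN raddfN /= IHs.
- by rewrite -wpiM rmorphM /= IHs IHt.
- by rewrite -wpiZ linearZ /= IHs.
Qed.

End UniversalProperty.

Definition lie_bracket (A : pzRingType) (a b : A) : A := a * b - b * a.

Definition traceless (K : fieldType) : {pred 'M[K]_2} := fun M => \tr M == 0.
Arguments traceless K M /.

Fact traceless_submod (K : fieldType) : submod_closed (@traceless K).
Proof.
split=> [|c M N]; rewrite /traceless ?unfold_in ?mxtrace0 //= => /eqP M0 /eqP N0.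
by rewrite mxtraceD mxtraceZ M0 N0 mulr0 addr0.
Qed.

HB.instance Definition _ (K : fieldType) :=
  GRing.isSubmodClosed.Build K 'M[K]_2 (@traceless K) (@traceless_submod K).

Record sl2 (K : fieldType) := Sl2 {
  sl2_mx :> 'M[K]_2;
  sl2_tr : sl2_mx \in @traceless K }.

HB.instance Definition _ (K : fieldType) := [isSub for @sl2_mx K].
HB.instance Definition _ (K : fieldType) := [Choice of sl2 K by <:].
HB.instance Definition _ (K : fieldType) := [SubChoice_isSubLmodule of sl2 K by <:].

Fact sl2_bracket_tr (K : fieldType) (M N : sl2 K) :
  lie_bracket (M : 'M[K]_2) (N : 'M[K]_2) \in @traceless K.
Proof. by rewrite unfold_in /= raddfB /= mxtrace_mulC subrr. Qed.

Definition sl2_bracket (K : fieldType) (M N : sl2 K) : sl2 K :=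
  Sl2 (sl2_bracket_tr M N).

Fact e_plus_tr (K : fieldType) : delta_mx 0 1 \in @traceless K.
Proof. by rewrite unfold_in /= /mxtrace !big_ord_recl big_ord0 !mxE addr0 addr0. Qed.
Fact e_minus_tr (K : fieldType) : delta_mx 1 0 \in @traceless K.
Proof. by rewrite unfold_in /= /mxtrace !big_ord_recl big_ord0 !mxE addr0 addr0. Qed.
Fact e_zero_tr (K : fieldType) : delta_mx 0 0 - delta_mx 1 1 \in @traceless K.
Proof.
by rewrite unfold_in /= /mxtrace !big_ord_recl big_ord0 !mxE /= subr0 sub0r addr0 subrr.
Qed.

Definition e_plus {K : fieldType} : sl2 K := Sl2 (e_plus_tr K).
Definition e_minus {K : fieldType} : sl2 K := Sl2 (e_minus_tr K).
Definition e_zero {K : fieldType} : sl2 K := Sl2 (e_zero_tr K).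

Local Open Scope classical_set_scope.

Definition realisation (K : fieldType) : set (sl2 K -> weyl K) :=
  [set f | [/\ linear f,
               {morph f : M N / sl2_bracket M N >-> lie_bracket M N}
             & injective f]].

Record weyl_aut (K : fieldType) := WeylAut {
  weyl_aut_fun :> {lrmorphism weyl K -> weyl K};
  weyl_aut_bij : bijective weyl_aut_fun }.

Record sl2_aut (K : fieldType) := Sl2Aut {
  sl2_aut_fun :> {linear sl2 K -> sl2 K};
  sl2_aut_inv : sl2 K -> sl2 K;
  sl2_aut_bracket : {morph sl2_aut_fun : M N / sl2_bracket M N};
  sl2_autK : cancel sl2_aut_fun sl2_aut_inv;
  sl2_aut_invK : cancel sl2_aut_inv sl2_aut_fun }.

Definition aut_act (K : fieldType) (alpha : weyl_aut K) (w : sl2_aut K)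
  (f : sl2 K -> weyl K) : sl2 K -> weyl K := alpha \o f \o sl2_aut_inv w.

Definition sl2_lin (K : fieldType) (x y h : weyl K) (M : sl2 K) : weyl K :=
  sl2_mx M 0 1 *: x + sl2_mx M 1 0 *: y + sl2_mx M 0 0 *: h.

Definition f_I (K : fieldType) : sl2 K -> weyl K :=
  let p := weyl_p in let q := weyl_q in
  sl2_lin (- (2^-1 *: q ^+ 2)) (2^-1 *: p ^+ 2) (2^-1 *: (p * q + q * p)).

Definition f_II (K : fieldType) (b : K) : sl2 K -> weyl K :=
  let p := weyl_p in let q := weyl_q in
  sl2_lin ((b%:A + p * q) * q) (- p) (2 *: (p * q) + b%:A).

Lemma sl2_linE (K : fieldType) (x y h : weyl K) :
  [/\ sl2_lin x y h e_plus = x, sl2_lin x y h e_minus = y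
    & sl2_lin x y h e_zero = h].
Proof.
by rewrite /sl2_lin /= !mxE /= !subr0 !scale0r !scale1r !add0r !addr0.
Qed.

Lemma sl2_lin_linear (K : fieldType) (x y h : weyl K) : linear (sl2_lin x y h).
Proof.
move=> c M N; rewrite /sl2_lin /= !mxE !scalerDl !scalerDr !scalerA.
by rewrite [RHS]addrACA; congr (_ + _); rewrite [RHS]addrACA.
Qed.

Definition sl2_triple (A : pzRingType) (x y h : A) :=
  [/\ lie_bracket h x = x *+ 2, lie_bracket h y = - (y *+ 2)
    & lie_bracket x y = h].

Section LieBracket.
Variables (K : fieldType) (A : algType K).
Implicit Types (a b c : A) (k : K).

Lemma lieDl a b c : lie_bracket (a + b) c = lie_bracket a c + lie_bracket b c.
Proof. by rewrite /lie_bracket mulrDl mulrDr opprD addrACA. Qed.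
Lemma lieC a b : lie_bracket a b = - lie_bracket b a.
Proof. by rewrite /lie_bracket opprB. Qed.
Lemma lieDr a b c : lie_bracket a (b + c) = lie_bracket a b + lie_bracket a c.
Proof. by rewrite lieC lieDl opprD -!(lieC a). Qed.
Lemma lieZl k a b : lie_bracket (k *: a) b = k *: lie_bracket a b.
Proof. by rewrite /lie_bracket -scalerAl -scalerAr scalerBr. Qed.
Lemma lieZr k a b : lie_bracket a (k *: b) = k *: lie_bracket a b.
Proof. by rewrite lieC lieZl -scalerN -lieC. Qed.
Lemma lieNl a b : lie_bracket (- a) b = - lie_bracket a b.
Proof. by rewrite -scaleN1r lieZl scaleN1r. Qed.
Lemma lieNr a b : lie_bracket a (- b) = - lie_bracket a b.
Proof. by rewrite -scaleN1r lieZr scaleN1r. Qed.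
Lemma lieid a : lie_bracket a a = 0.
Proof. exact: subrr. Qed.
Lemma lieMl a b c : lie_bracket (a * b) c = a * lie_bracket b c + lie_bracket a c * b.
Proof. by rewrite /lie_bracket mulrBr mulrBl !mulrA addrA subrK. Qed.
Lemma lieMr a b c : lie_bracket a (b * c) = lie_bracket a b * c + b * lie_bracket a c.
Proof. by rewrite /lie_bracket mulrBr mulrBl !mulrA addrA subrK. Qed.
Lemma lie1l a : lie_bracket 1 a = 0.
Proof. by rewrite /lie_bracket mul1r mulr1 subrr. Qed.

End LieBracket.

Lemma lin3 (K : fieldType) (V : lmodType K) (x y z : V) :
  exists L : K -> K -> K -> V, [/\
    forall u v w u' v' w',
      L u v w + L u' v' w' = L (u + u') (v + v') (w + w'),
    forall k u v w, k *: L u v w = L (k * u) (k * v) (k * w)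
  & [/\ x = L 1 0 0, y = L 0 1 0 & z = L 0 0 1]].
Proof.
exists (fun u v w => u *: x + v *: y + w *: z); split.
- move=> *; rewrite !scalerDl [LHS]addrACA; congr (_ + _); exact: addrACA.
- by move=> *; rewrite !scalerDr !scalerA.
- by rewrite !scale0r !scale1r !(add0r, addr0).
Qed.

Lemma sl2_triple_realisation (K : numFieldType) (x y h : weyl K) :
  sl2_triple x y h -> x != 0 -> realisation (sl2_lin x y h).
Proof.
move=> [hx hy xy] x0.
have lin := sl2_lin_linear x y h.
have tr (M : sl2 K) : sl2_mx M 1 1 = - sl2_mx M 0 0.
  apply/eqP; rewrite -addr_eq0 addrC.
  have /eqP := sl2_tr M; rewrite /mxtrace !big_ord_recl big_ord0 addr0 => E.
  by apply/eqP; rewrite -{}[RHS]E; congr (_ + sl2_mx M _ _); apply/val_inj.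
have brak : {morph sl2_lin x y h : M N / sl2_bracket M N >-> lie_bracket M N}.
  move=> M N.
  have E i j : sl2_mx (sl2_bracket M N) i j =
     sl2_mx M i 0 * sl2_mx N 0 j + sl2_mx M i 1 * sl2_mx N 1 j
     - (sl2_mx N i 0 * sl2_mx M 0 j + sl2_mx N i 1 * sl2_mx M 1 j).
    rewrite /= /lie_bracket !mxE !big_ord_recl !big_ord0 !addr0.
    by rewrite (_ : lift ord0 ord0 = 1) //; apply/val_inj.
  rewrite {1}/sl2_lin !E !tr /sl2_lin.
  move: (sl2_mx M 0 1) (sl2_mx M 1 0) (sl2_mx M 0 0) => a b c.
  move: (sl2_mx N 0 1) (sl2_mx N 1 0) (sl2_mx N 0 0) => a' b' c'.
  rewrite !(lieDl, lieDr) !(lieZl, lieZr) (lieid x) (lieid y) (lieid h) (lieC x h) (lieC y h) (lieC y x).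
  rewrite hx hy xy !scaler0 opprK -!scaler_nat !(add0r, addr0).
  rewrite -(scaleN1r (2 *: x)) -(scaleN1r (2 *: y)) -(scaleN1r h) !scalerA.
  have [L [LD LZ [-> -> ->]]] := lin3 x y h.
  rewrite !LZ !LD; congr L; ring.
split=> // M N MN.
have fM0 : sl2_lin x y h (M - N) = 0.
  have := lin (-1) N M; rewrite scaleN1r MN scaleN1r addNr addrC.
  by [].
set P := M - N in fM0; have {fM0} : sl2_mx P 0 1 *: x + sl2_mx P 1 0 *: y + sl2_mx P 0 0 *: h = 0.
  exact: fM0.
have PE i j : sl2_mx P i j = sl2_mx M i j - sl2_mx N i j by rewrite /P /= !mxE.
move: (PE 0 1) (PE 1 0) (PE 0 0); move: (sl2_mx P 0 1) (sl2_mx P 1 0) (sl2_mx P 0 0).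
move=> a b c aE bE cE abc0.
have two0 : (2 : K) != 0 by rewrite pnatr_eq0.
have xh : lie_bracket x h = - (2 *: x) by rewrite lieC hx scaler_nat.
have e1 : b *: h - (c * 2) *: x = 0.
  have := congr1 (lie_bracket x) abc0.
  rewrite !lieDr !lieZr (lieid x) xy xh scaler0 add0r scalerN scalerA => ->.
  by rewrite /lie_bracket mulr0 mul0r subrr.
have b0 : b = 0.
  have := congr1 (lie_bracket x) e1.
  rewrite lieDr lieNr !lieZr (lieid x) xh scaler0 subr0 scalerN scalerA.
  rewrite {1}/lie_bracket mulr0 mul0r subrr => /eqP.
  by rewrite oppr_eq0 scaler_eq0 (negPf x0) orbF mulf_eq0 (negPf two0) orbF => /eqP.
have c0 : c = 0.
  move/eqP: e1; rewrite b0 scale0r sub0r oppr_eq0 scaler_eq0 (negPf x0) orbF.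
  by rewrite mulf_eq0 (negPf two0) orbF => /eqP.
have a0 : a = 0.
  move/eqP: abc0; rewrite b0 c0 !scale0r !addr0 scaler_eq0 (negPf x0) orbF.
  by move/eqP.
have I2 (i : 'I_2) : i = 0 \/ i = 1.
  by case: i => [[|[|]]] // ?; [left|right]; apply/val_inj.
move: aE bE cE; rewrite a0 b0 c0.
move=> /esym/subr0_eq a1 /esym/subr0_eq b1 /esym/subr0_eq c1.
apply/val_inj/matrixP => i j /=.
by case: (I2 i) => ->; case: (I2 j) => ->; rewrite ?tr ?c1.
Qed.

Section Realisations.
Variable K : numFieldType.
Local Notation p := (@weyl_p K).
Local Notation q := (@weyl_q K).

Lemma weyl_pq : lie_bracket p q = 1. Proof. exact: weyl_rel. Qed.
Lemma weyl_qp : lie_bracket q p = -1. Proof. by rewrite lieC weyl_pq. Qed.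

Lemma weyl_qpE : q * p = p * q - 1.
Proof. by rewrite -weyl_pq /lie_bracket opprB addrCA subrr addr0. Qed.

Lemma f_I_realisation : realisation (f_I (K:=K)).
Proof.
have two0 : (2 : K) != 0 by rewrite pnatr_eq0.
have half (a : weyl K) : 2^-1 *: (a + a) = a.
  by rewrite -mulr2n -scaler_nat scalerA mulVf // scale1r.
pose h := 2^-1 *: (p * q + q * p).
have hp : lie_bracket h p = - p.
  rewrite /h lieZl lieDl !lieMl !lieid weyl_qp mulrN1 mulN1r mul0r mulr0 addr0 add0r.
  by rewrite -opprD scalerN half.
have hq : lie_bracket h q = q.
  rewrite /h lieZl lieDl !lieMl !lieid weyl_pq mulr1 mul1r mul0r mulr0 addr0 add0r.
  exact: half.
apply: sl2_triple_realisation.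
  split.
  - by rewrite lieNr lieZr expr2 lieMr hq mulr2n scalerDr opprD.
  - by rewrite lieZr expr2 lieMr hp mulNr mulrN mulr2n -opprD scalerN scalerDr.
  - rewrite lieNl lieZl lieZr !expr2 !(lieMl, lieMr) weyl_qp.
    rewrite !mulrN1 !mulN1r -opprD mulrN mulNr -opprD !scalerN opprK.
    by rewrite mulrDr mulrDl addrACA half addrC.
apply/eqP => /(congr1 (fun a => weyl_act a 1)).
rewrite weyl_act0 -scaleN1r expr2 !weyl_actE scalerA => /eqP.
rewrite scaler_eq0 !mulf_eq0 oner_eq0 polyX_eq0 !orbF oppr_eq0 oner_eq0 invr_eq0.
by rewrite (negPf two0).
Qed.

Lemma f_II_triple b :
  sl2_triple ((b%:A + p * q) * q) (- p) (2 *: (p * q) + b%:A).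
Proof.
have tq : lie_bracket (p * q) q = q by rewrite lieMl lieid weyl_pq mulr0 mul1r add0r.
have tp : lie_bracket (p * q) p = - p by rewrite lieMl lieid weyl_qp mul0r mulrN1 addr0.
have tb a : lie_bracket (b%:A) a = 0 :> weyl K by rewrite lieZl lie1l scaler0.
split.
- rewrite lieDl tb addr0 lieZl lieMr lieDr lieid lieC tb oppr0 addr0 mul0r add0r tq.
  by rewrite scaler_nat.
- by rewrite lieDl tb addr0 lieZl lieNr tp opprK scaler_nat mulNrn opprK.
- rewrite lieNr lieMl weyl_qp mulrN1 lieDl tb add0r tp mulNr -opprD opprK.
  by rewrite scaler_nat mulr2n -addrA addrC.
Qed.

Lemma f_II_neq0 b : (b%:A + p * q) * q != 0.
Proof.
apply/eqP => x0.
have := congr1 (fun a => weyl_act a 1) x0; have := congr1 (fun a => weyl_act a 'X) x0.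
rewrite weyl_act0 !weyl_actE !mulr1 -!expr2 -exprS !derivXn /=.
rewrite -!scaler_nat -!scalerDl => /eqP; rewrite scaler_eq0 expf_eq0 polyX_eq0 orbF.
move=> /eqP b3 /eqP; rewrite scaler_eq0 polyX_eq0 orbF => /eqP b2.
have : (1 : K) = (b + 3) - (b + 2) by ring.
by rewrite b3 b2 subrr => /eqP; rewrite oner_eq0.
Qed.

Lemma f_II_realisation b : realisation (f_II b : sl2 K -> _).
Proof. exact: sl2_triple_realisation (f_II_triple b) (f_II_neq0 b). Qed.

Lemma twisted_triple (A : algType K) (x y h : A) : sl2_triple x y h ->
  sl2_triple x (y + (x * h + h * x) - 4 *: x ^+ 3) (h - 4 *: x ^+ 2).
Proof.
move=> [hx hy xy].
have xh : lie_bracket x h = - (x *+ 2) by rewrite lieC hx.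
have xxh : lie_bracket (x ^+ 2) h = - (x ^+ 2 *+ 4).
  by rewrite expr2 lieMl xh mulrN mulNr mulrnAl mulrnAr -opprD -mulrnDr.
have xX n : lie_bracket x (x ^+ n) = 0.
  by rewrite /lie_bracket -exprS -exprSr subrr.
have Xx n : lie_bracket (x ^+ n) x = 0 by rewrite lieC xX oppr0.
have XX : lie_bracket (x ^+ 2) (x ^+ 3) = 0.
  by rewrite /lie_bracket -!exprD subrr.
split.
- by rewrite lieDl lieNl lieZl hx Xx scaler0 subr0.
- set z := x * h + h * x.
  have hz : lie_bracket h z = z *+ 2.
    rewrite /z lieDr !lieMr hx lieid mulr0 mul0r addr0 add0r.
    by rewrite mulrnAl mulrnAr -mulrnDl.
  have xxy : lie_bracket (x ^+ 2) y = z by rewrite expr2 lieMl xy.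
  have xxz : lie_bracket (x ^+ 2) z = - (x ^+ 3 *+ 8).
    rewrite /z lieDr !lieMr xxh Xx.
    rewrite mulr0 mul0r addr0 add0r mulrN mulNr mulrnAl mulrnAr -exprS -exprSr.
    by rewrite -opprD -mulrnDr.
  have hx3 : lie_bracket h (x ^+ 3) = x ^+ 3 *+ 6.
    rewrite !exprS expr0 mulr1 !lieMr hx !mulrDr !mulrnAl !mulrnAr !mulrA.
    by rewrite !(mulrS, mulr0n, addr0, addrA).
  clearbody z; rewrite !(lieDl, lieDr, lieNl, lieNr, lieZl, lieZr) hy hz hx3 xxy xxz XX.
  rewrite !scalerN !scaler0 !oppr0 !addr0.
  have [L [LD LZ [-> -> ->]]] := lin3 y z (x ^+ 3).
  rewrite -!scaler_nat -!scaleN1r !scalerDr !scalerA.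
  by rewrite !(LZ, LD); congr L; ring.
- rewrite !lieDr lieNr lieZr xX scaler0 oppr0 addr0 xy !lieMr lieid xh.
  rewrite mul0r mulr0 add0r addr0 mulrN mulNr mulrnAl mulrnAr -opprD.
  by rewrite -expr2 scaler_nat !(mulrS, mulr0n, addr0, addrA).
Qed.

Lemma g_realisation : exists g : sl2 K -> weyl K, [/\ realisation g,
  g e_plus = (1 + p * q) * q,
  g e_minus = - p + 4 *: (p ^+ 2 * q ^+ 3) - 4 *: (p ^+ 3 * q ^+ 6)
              + 12 *: (p ^+ 2 * q ^+ 5)
& g e_zero = 2 *: (p * q) - 4 *: (p ^+ 2 * q ^+ 4) + 1].
Proof.
have q1p a : q * (p * a) = p * (q * a) - a.
  by rewrite mulrA weyl_qpE mulrBl mul1r mulrA.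
pose x := (1 + p * q) * q; pose h : weyl K := 2 *: (p * q) + 1%:A.
have xE : x = q + p * q ^+ 2 by rewrite /x mulrDl mul1r -mulrA -expr2.
have x2E : x ^+ 2 = p ^+ 2 * q ^+ 4.
  rewrite xE !exprS !expr0 !mulr1 !(mulrDl, mulrDr) -!mulrA !(q1p, mulrBr).
  have [L [LD LZ [Ea Eb Ec]]] :=
    lin3 (p * (p * (q * (q * (q * q))))) (p * (q * (q * q))) (q * q).
  rewrite Ea Eb Ec -!scaleN1r !(LZ, LD); congr L; ring.
have x3E : x ^+ 3 = p ^+ 3 * q ^+ 6 - 3 *: (p ^+ 2 * q ^+ 5).
  rewrite exprS x2E xE !exprS !expr0 !mulr1 !(mulrDl, mulrDr) -!mulrA.
  rewrite !(q1p, mulrBr).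
  have [L [LD LZ [Ea Eb Ec]]] :=
    lin3 (p * (p * (p * (q * (q * (q * (q * (q * q))))))))
      (p * (p * (q * (q * (q * (q * q)))))) (p * (q * (q * (q * q)))).
  rewrite Ea Eb Ec -!scaleN1r !(LZ, LD); congr L; ring.
have xhE : x * h + h * x = 4 *: (p ^+ 2 * q ^+ 3).
  rewrite xE /h scale1r !exprS !expr0 ?mulr1 !(mulrDl, mulrDr) !(mulr1, mul1r).
  rewrite -!scalerAl -!scalerAr -!mulrA. rewrite !(q1p, mulrBr).
  have [L [LD LZ [Ea Eb Ec]]] := lin3 (p * (p * (q * (q * q)))) (p * (q * q)) q.
  rewrite Ea Eb Ec -!scaleN1r !(LZ, LD); congr L; ring.
have xE1 : x = (1%:A + p * q) * q by rewrite scale1r.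
have /twisted_triple T : sl2_triple x (- p) h by rewrite xE1; apply: f_II_triple.
exists (sl2_lin x (- p + (x * h + h * x) - 4 *: x ^+ 3) (h - 4 *: x ^+ 2)).
have [-> -> ->] := sl2_linE x (- p + (x * h + h * x) - 4 *: x ^+ 3) (h - 4 *: x ^+ 2).
split=> //.
- by apply: sl2_triple_realisation => //; rewrite xE1 f_II_neq0.
- by rewrite xhE x3E scalerBr opprB scalerA -natrM addrA addrAC.
- by rewrite x2E /h scale1r addrAC.
Qed.

End Realisations.

Definition normal_forms (K : fieldType) : set (sl2 K -> weyl K) :=
  [set f_I (K:=K)] `|` range (@f_II K).

Definition normalisable (K : fieldType) : set (sl2 K -> weyl K) :=
  [set f | realisation f /\
     exists (alpha : weyl_aut K) (w : sl2_aut K),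
       normal_forms (aut_act alpha w f)].

(* Main.v *)
Require Import Defs.
From HB Require Import structures.
From mathcomp Require Import all_boot all_order all_algebra.
From mathcomp Require Import boolp classical_sets reals complex.
From mathcomp Require Import ring zify.

(** Realisations that can be normalised are detected by ad-nilpotency. Both
    [f_I e_plus = - q^2 / 2] and [f_II b e_minus = - p] act locally nilpotently
    on the Weyl algebra through the adjoint action. Automorphisms preserve this,
    so a realisation [g] that can be normalised has a nonzero [m] in sl(2) such
    that [ad (g m)] is locally nilpotent ([normal_form_ad_nilpotent]).

    For the given [g] there is no such [m]: [ad (g m)] is not nilpotent on [q],
    whatever the nonzero [m] is ([symbol_not_ad_nilpotent] applied to
    [symbol_realisation_g]). To see this, let the Weyl algebra act on
    polynomials by [p = d/dX] and [q = X], and use the basis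
    [v_n = (n + 2)`! X^n]. There [g e_plus] sends [v_n] to [v_(n+1)] exactly,
    while [g e_zero] and [g e_minus] send it to [-4 v_(n+2)] and [-4 v_(n+3)] up
    to lower terms: they are the twists of [f_II 1] by
    [exp (ad (e_plus ^+ 2))], whose leading terms are [-4 x^2] and [-4 x^3] with
    [x = g e_plus]. Hence every [g m] with [m] nonzero has, at the top degree
    [r] (1, 2 or 3), a constant nonzero coefficient [c]. As [q] sends [v_n] to
    [v_(n+1) / (n + 3)], each bracket with [g m] replaces the leading
    coefficient [t n] by [c (t n - t (n + r))]. Starting from [1 / (n + 3)], the
    [k]-th such difference is
    [c^k k! r^k / ((n + 3) (n + 3 + r) ... (n + 3 + k r))], never zero. *)

Set Implicit Arguments.
Unset Strict Implicit.

Import GRing.Theory Num.Theory.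
Local Open Scope ring_scope.

(** * Elements on which an inner derivation is nilpotent *)

Section LocallyNilpotent.
Variables (K : fieldType) (A : algType K).
Implicit Types (s a b : A) (k l : nat).

Definition ad_nilpotent s a := exists k, iter k (lie_bracket s) a = 0.

Lemma iter_ad0 s k : iter k (lie_bracket s) 0 = 0.
Proof. by elim: k => //= k ->; rewrite /lie_bracket mulr0 mul0r subrr. Qed.

Lemma iter_adD s k : {morph iter k (lie_bracket s) : a b / a + b}.
Proof. by elim: k => // k IH a b; rewrite /= IH lieDr. Qed.

Lemma iter_adZ s k (c : K) a :
  iter k (lie_bracket s) (c *: a) = c *: iter k (lie_bracket s) a.
Proof. by elim: k => //= k ->; rewrite lieZr. Qed.

Lemma iter_ad_eq0 s k l a :
  (k <= l)%N -> iter k (lie_bracket s) a = 0 -> iter l (lie_bracket s) a = 0.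
Proof. by move=> kl a0; rewrite -(subnK kl) iterD a0 iter_ad0. Qed.

Lemma ad_nilpotent1 s : ad_nilpotent s 1.
Proof. by exists 1%N; rewrite /= lieC lie1l oppr0. Qed.

Lemma ad_nilpotentD s a b :
  ad_nilpotent s a -> ad_nilpotent s b -> ad_nilpotent s (a + b).
Proof.
move=> [k a0] [l b0]; exists (k + l)%N.
by rewrite iter_adD (iter_ad_eq0 (leq_addr l k) a0) (iter_ad_eq0 (leq_addl k l) b0) addr0.
Qed.

Lemma ad_nilpotentZ s (c : K) a : ad_nilpotent s a -> ad_nilpotent s (c *: a).
Proof. by move=> [k a0]; exists k; rewrite iter_adZ a0 scaler0. Qed.

(** The bracket with [s] is a derivation, so each application to a product
    spends one of the [k + l] applications on one of the two factors. *)
Lemma ad_nilpotentM s a b :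
  ad_nilpotent s a -> ad_nilpotent s b -> ad_nilpotent s (a * b).
Proof.
move=> [k a0] [l b0]; exists (k + l)%N.
have [m] := ubnP (k + l); elim: m k l a b a0 b0 => // m IH [|k] [|l] a b.
- by move=> /= -> _ _; rewrite mul0r.
- by move=> /= -> _ _; rewrite mul0r -/(iter l.+1 _ _) iter_ad0.
- by move=> _ /= -> _; rewrite mulr0 -/(iter (k + 0).+1 _ _) iter_ad0.
move=> a0 b0 klm; rewrite addSn iterSr lieMr iter_adD.
rewrite (IH k l.+1 (lie_bracket s a) b) //; first last.
- by rewrite -iterSr.
rewrite add0r addnS -addSn (IH k.+1 l a (lie_bracket s b)) //.
- by rewrite -iterSr.
- by move: klm; rewrite !addSn !addnS.
Qed.

End LocallyNilpotent.

Lemma rmorph_iter_ad (K : fieldType) (A B : algType K)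
    (alpha : {lrmorphism A -> B}) s a k :
  alpha (iter k (lie_bracket s) a) = iter k (lie_bracket (alpha s)) (alpha a).
Proof. by elim: k => //= k <-; rewrite rmorphB !rmorphM. Qed.

(** Sums, products and multiples preserve nilpotency, so it is enough to test
    the two generators. *)
Lemma weyl_ad_nilpotent (K : fieldType) (s : weyl K) :
  ad_nilpotent s weyl_p -> ad_nilpotent s weyl_q ->
  forall a, ad_nilpotent s a.
Proof.
move=> sp sq; elim/weylW; elim=> [||||t IHt u IHu|t IHt|t IHt u IHu|c t IHt] //.
- by exists 0%N.
- exact: ad_nilpotent1.
- by rewrite -wpiD; apply: ad_nilpotentD.
- by rewrite -wpiN -scaleN1r; apply: ad_nilpotentZ.
- by rewrite -wpiM; apply: ad_nilpotentM.
- by rewrite -wpiZ; apply: ad_nilpotentZ.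
Qed.

Lemma ad_nilpotent_p (K : numFieldType) (a : weyl K) : ad_nilpotent (- weyl_p) a.
Proof.
apply: weyl_ad_nilpotent.
- by exists 1%N; rewrite /= lieNl lieid oppr0.
- by exists 2%N; rewrite /= (lieNl weyl_p weyl_q) weyl_pq lieNr lieC lie1l !oppr0.
Qed.

Lemma ad_nilpotent_q2 (K : numFieldType) (c : K) (a : weyl K) :
  ad_nilpotent (c *: weyl_q ^+ 2) a.
Proof.
have q2q : lie_bracket (c *: weyl_q ^+ 2) weyl_q = 0 :> weyl K.
  by rewrite lieZl expr2 lieMl lieid mulr0 mul0r addr0 scaler0.
apply: weyl_ad_nilpotent; last by exists 1%N.
exists 2%N; rewrite /= [X in lie_bracket _ X](_ : _ = (c * -2) *: weyl_q).
  by rewrite lieZr q2q scaler0.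
rewrite lieZl expr2 lieMl weyl_qp mulrN1 mulN1r -opprD -mulr2n -scaler_nat.
by rewrite -scaleNr scalerA.
Qed.

(** * Leading coefficients of operators on polynomials *)

Section Symbols.
Variable K : numFieldType.
Implicit Types (a b : weyl K) (d e n : nat) (s t : nat -> K) (f : {poly K}).

(** In the basis [v_n = (n + 2)`! X^n], the operator [a] sends [v_n] to
    [t n v_(n+d)] plus terms of lower degree. The factorial makes the symbol of
    [(1 + p q) q], which sends [X^n] to [(n + 3) X^(n+1)], equal to [1]. The
    degree [d] is only an upper bound, so [t] may vanish. *)
Definition has_symbol d t a := forall n f, (size f <= n.+1)%N ->
  (size (weyl_act a f) <= (n + d).+1)%N /\
  (weyl_act a f)`_(n + d) / (n + d).+2`!%:R = t n * (f`_n / n.+2`!%:R).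

Lemma eq_symbol d s t a : s =1 t -> has_symbol d s a -> has_symbol d t a.
Proof. by move=> st sa n f /sa[? ?]; rewrite -st. Qed.

Lemma symbolD d s t a b :
  has_symbol d s a -> has_symbol d t b -> has_symbol d (fun n => s n + t n) (a + b).
Proof.
move=> sa tb n f fn; have [[sza ca] [szb cb]] := (sa n f fn, tb n f fn).
rewrite weyl_actD coefD !mulrDl ca cb; split=> //.
by rewrite (leq_trans (size_polyD _ _)) // geq_max sza szb.
Qed.

Lemma symbolZ d t (c : K) a : has_symbol d t a -> has_symbol d (fun n => c * t n) (c *: a).
Proof.
move=> ta n f /ta[sza ca]; rewrite weyl_actZ coefZ -!mulrA ca mulrA; split=> //.
exact: leq_trans (size_scale_leq _ _) sza.
Qed.

Lemma symbolM d e s t a b :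
  has_symbol d s a -> has_symbol e t b ->
  has_symbol (e + d) (fun n => s (n + e)%N * t n) (a * b).
Proof.
move=> sa tb n f fn; have [szb cb] := tb n f fn; have [sza ca] := sa _ _ szb.
by rewrite weyl_actM addnA; split=> //; rewrite ca cb mulrA.
Qed.

Lemma symbol_lower d e t a : (d < e)%N -> has_symbol d t a -> has_symbol e (fun=> 0) a.
Proof.
move=> de ta n f /ta[sza _]; split; first by rewrite (leq_trans sza) // ltnS leq_add2l ltnW.
by rewrite nth_default ?mul0r // (leq_trans sza) // -addnS leq_add2l.
Qed.

(** The leading terms of [a * b] and [b * a] need not cancel, since each
    operator shifts the argument of the symbol of the other. *)
Lemma symbol_ad d e s t a b :
  has_symbol d s a -> has_symbol e t b ->
  has_symbol (e + d) (fun n => s (n + e)%N * t n - t (n + d)%N * s n) (lie_bracket a b).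
Proof.
move=> sa tb.
apply: (@eq_symbol _ (fun n => s (n + e)%N * t n + -1 * (t (n + d)%N * s n))).
  by move=> n; rewrite mulN1r.
rewrite /lie_bracket -[- (b * a)]scaleN1r; apply: symbolD; first exact: symbolM.
by apply: symbolZ; rewrite addnC; apply: symbolM.
Qed.

Lemma weyl_act_monomial i j f :
  weyl_act (weyl_p ^+ i * weyl_q ^+ j) f = ('X^j * f)^`(i).
Proof.
elim: i j f => [|i IH] j f.
  rewrite mul1r derivn0; elim: j f => [|j IH] f; first by rewrite weyl_act1 mul1r.
  by rewrite exprS weyl_actM IH weyl_act_q exprS mulrA.
by rewrite exprS -mulrA weyl_actM IH weyl_act_p derivnS.
Qed.

(** The denominator is [(n + d + 2)`! / (n + 2)`!] with [d = j - i], from the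
    choice of basis. *)
Lemma symbol_monomial i j : (i <= j)%N ->
  has_symbol (j - i)
    (fun n => ((n + j) ^_ i)%:R / ((n + (j - i)).+2 ^_ (j - i))%:R)
    (weyl_p ^+ i * weyl_q ^+ j).
Proof.
move=> ij n f fn; rewrite weyl_act_monomial; split.
  apply/leq_sizeP => k nk; rewrite coef_derivn coefXnM.
  by rewrite nth_default ?if_same ?mul0rn //; move: (size f) fn => m fn; lia.
have nji : (n + (j - i) + i = n + j)%N by rewrite -addnA subnK.
rewrite coef_derivn addnC nji coefXnM ltnNge leq_addl /= addnK -mulr_natr.
have nz m : m`!%:R != 0 :> K by rewrite pnatr_eq0 -lt0n fact_gt0.
have le : (j - i <= (n + (j - i)).+2)%N by lia.
have fE := ffact_fact le.
rewrite (_ : (n + (j - i)).+2 - (j - i) = n.+2)%N in fE; last by lia.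
have fz : ((n + (j - i)).+2 ^_ (j - i))%:R != 0 :> K.
  by rewrite pnatr_eq0 -lt0n ffact_gt0.
by rewrite -fE natrM; field; rewrite fz nz.
Qed.

Lemma natS_neq0 n : n.+1%:R != 0 :> K. Proof. by rewrite pnatr_eq0. Qed.

Lemma symbol_q : has_symbol 1 (fun n => n.+3%:R^-1) (weyl_q : weyl K).
Proof.
rewrite -[weyl_q]mul1r -(expr0 weyl_p) -[weyl_q]expr1.
apply: eq_symbol (@symbol_monomial 0 1 isT) => n /=.
by rewrite ffactn0 addn1 ffactn1 mul1r.
Qed.

(** The symbol of [q] is [1 / (n + 3)]; this is the closed form of its [k]-th
    iterated difference with step [r], multiplied by [(- c)^k]. *)
Definition iter_symbol (c : K) (r k n : nat) : K :=
  c ^+ k * (k`! * r ^ k)%N%:R / (\prod_(j < k.+1) (n + 3 + j * r))%N%:R.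

(** The two products have all their factors in common except [n + 3] and
    [n + 3 + (k + 1) r], whose difference [(k + 1) r] feeds the factorial and
    the power in the numerator. *)
Lemma iter_symbol_step c r k n :
  c * iter_symbol c r k n - iter_symbol c r k (n + r) * c = iter_symbol c r k.+1 n.
Proof.
rewrite /iter_symbol big_ord_recl [in RHS]big_ord_recr [in RHS]big_ord_recl /=.
rewrite [(\prod_(i < k.+1) _)%N]big_ord_recr /=.
pose P := (\prod_(i < k) (n + 3 + i.+1 * r))%N.
have -> : (\prod_(i < k) (n + r + 3 + i * r) = P)%N.
  by apply: eq_bigr => i _; rewrite mulSn; lia.
rewrite [(\prod_(i < k) (n + 3 + bump 0 i * r))%N](_ : _ = P) //.
have P0 : P%:R != 0 :> K.
  by rewrite pnatr_eq0 -lt0n prodn_gt0 // => i; rewrite addn3.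
rewrite mul0n addn0 (_ : n + r + 3 + k * r = n + 3 + k.+1 * r)%N; last by rewrite mulSn; lia.
have n0 : (n + 3)%:R != 0 :> K by rewrite addn3 natS_neq0.
have nk0 : (n + 3 + k.+1 * r)%:R != 0 :> K by rewrite addn3 !addSn natS_neq0.
rewrite factS expnS exprS !natrM; move: P0 n0 nk0.
rewrite !natrD natrM -[k.+1%:R]natr1.
move: P%:R (n%:R) (k%:R) (r%:R) (k`!%:R) ((r ^ k)%:R) (c ^+ k) => x y z t u v w.
by move=> x0 y0 z0; field; rewrite x0 y0 z0.
Qed.

Lemma symbol_iter_ad c r (s : weyl K) k : has_symbol r (fun=> c) s ->
  has_symbol (1 + k * r) (iter_symbol c r k) (iter k (lie_bracket s) weyl_q).
Proof.
move=> sc; elim: k => [|k IH].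
  apply: eq_symbol symbol_q => n.
  by rewrite /iter_symbol big_ord1 mul0n addn0 addn3 fact0 expn0 muln1 expr0 !mul1r.
rewrite mulSn addnCA addnC; apply: eq_symbol (symbol_ad sc IH) => n /=.
exact: iter_symbol_step.
Qed.

(** The constant polynomial [1] detects that no iterated bracket of [q]
    vanishes, because the closed form of its symbol is nonzero at [n = 0]. *)
Lemma symbol_not_ad_nilpotent c r (s : weyl K) :
  c != 0 -> (0 < r)%N -> has_symbol r (fun=> c) s -> ~ ad_nilpotent s weyl_q.
Proof.
move=> c0 r0 sc [k sk].
have [|_] := symbol_iter_ad k sc (n := 0) (f := 1); first by rewrite size_poly1.
rewrite sk weyl_act0 coef0 mul0r coef1 /= mul1r => /esym/eqP.
rewrite !mulf_eq0 !invr_eq0 !pnatr_eq0 expf_eq0 (negPf c0) andbF /=.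
rewrite muln_eq0 expn_eq0 !(negPf (lt0n_neq0 _)) ?fact_gt0 //.
by rewrite prodn_gt0 // => i.
Qed.

(** * The twisted realisation has constant symbols *)

Lemma symbol_g_plus :
  has_symbol 1 (fun=> 1) ((1 + weyl_p * weyl_q) * weyl_q : weyl K).
Proof.
rewrite mulrDl mul1r -mulrA -expr2.
apply: eq_symbol (symbolD symbol_q (@symbol_monomial 1 2 isT)) => n.
rewrite !addnS addn0 !(ffactnS, ffactn0) /= !muln1.
by field; rewrite -natrD pnatr_eq0.
Qed.

(** The symbol is that of [- 4 x ^+ 2] with [x = (1 + p q) q], which equals
    [- 4 p^2 q^4]; the other two terms have degree 0. *)
Lemma symbol_g_zero : has_symbol 2 (fun=> -4)
  (2 *: (weyl_p * weyl_q) - 4 *: (weyl_p ^+ 2 * weyl_q ^+ 4) + 1 : weyl K).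
Proof.
have lower1 : has_symbol 2 (fun=> 0) (1 : weyl K).
  by rewrite -[1]mulr1; apply: symbol_lower (@symbol_monomial 0 0 isT).
have lowerpq : has_symbol 2 (fun=> 0) (weyl_p * weyl_q : weyl K).
  exact: symbol_lower (@symbol_monomial 1 1 isT).
rewrite -scaleNr.
apply: eq_symbol (symbolD (symbolD (symbolZ 2 lowerpq)
  (symbolZ (- 4) (@symbol_monomial 2 4 isT))) lower1) => n.
rewrite !addnS addn0 !(ffactnS, ffactn0) /= !muln1 !natrM.
by field; rewrite -!natrD !pnatr_eq0.
Qed.

(** The symbol is that of [- 4 x ^+ 3] with [x = (1 + p q) q], which equals
    [- 4 p^3 q^6 + 12 p^2 q^5]; neither of these two terms alone has a constant
    symbol. *)
Lemma symbol_g_minus : has_symbol 3 (fun=> -4)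
  (- weyl_p + 4 *: (weyl_p ^+ 2 * weyl_q ^+ 3)
       - 4 *: (weyl_p ^+ 3 * weyl_q ^+ 6) + 12 *: (weyl_p ^+ 2 * weyl_q ^+ 5) : weyl K).
Proof.
have lowerp : has_symbol 3 (fun=> 0) (- weyl_p : weyl K).
  rewrite -scaleN1r; apply: eq_symbol (symbolZ _ _) => [n|]; first exact: mulr0.
  suff : has_symbol 0 (fun=> 0) (weyl_p : weyl K) by apply: symbol_lower.
  move=> n f fn; rewrite weyl_act_p addn0.
  have coef0 k : (n <= k)%N -> (f^`())`_k = 0.
    by move=> nk; rewrite coef_deriv nth_default ?mul0rn // (leq_trans fn).
  by rewrite coef0 // !mul0r; split=> //; apply/leq_sizeP => k /ltnW/coef0.
have lowerp2q3 : has_symbol 3 (fun=> 0) (weyl_p ^+ 2 * weyl_q ^+ 3 : weyl K).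
  exact: symbol_lower (@symbol_monomial 2 3 isT).
rewrite -scaleNr.
apply: eq_symbol (symbolD (symbolD (symbolD lowerp (symbolZ 4 lowerp2q3))
  (symbolZ (- 4) (@symbol_monomial 3 6 isT)))
  (symbolZ 12 (@symbol_monomial 2 5 isT))) => n.
rewrite !addnS addn0 !(ffactnS, ffactn0) /= !muln1 !natrM.
by field; rewrite -!natrD !pnatr_eq0.
Qed.

(** The degrees 3, 2, 1 of the images of [e_minus], [e_zero], [e_plus] are
    distinct, so the leading term of a combination comes from the first of them
    with a nonzero coefficient and cannot cancel. *)
Lemma symbol_realisation_g (a b c : K) : (a, b, c) != 0 ->
  exists (r : nat) (l : K), [/\ (0 < r)%N, l != 0 & has_symbol r (fun=> l)
    (a *: ((1 + weyl_p * weyl_q) * weyl_q)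
   + b *: (- weyl_p + 4 *: (weyl_p ^+ 2 * weyl_q ^+ 3)
       - 4 *: (weyl_p ^+ 3 * weyl_q ^+ 6) + 12 *: (weyl_p ^+ 2 * weyl_q ^+ 5))
   + c *: (2 *: (weyl_p * weyl_q) - 4 *: (weyl_p ^+ 2 * weyl_q ^+ 4) + 1))].
Proof.
have four : - 4 != 0 :> K by rewrite oppr_eq0 pnatr_eq0.
have [[x y] h] := (symbolZ a symbol_g_plus, symbolZ b symbol_g_minus, symbolZ c symbol_g_zero).
have [-> | b0 _] := eqVneq b 0; last first.
  exists 3, (b * - 4); split; rewrite ?mulf_neq0 //.
  apply: eq_symbol (symbolD (symbolD (symbol_lower _ x) y) (symbol_lower _ h)) => // n.
  by rewrite addr0 add0r.
rewrite scale0r addr0; have [-> | c0 _] := eqVneq c 0; last first.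
  exists 2, (c * - 4); split; rewrite ?mulf_neq0 //.
  apply: eq_symbol (symbolD (symbol_lower _ x) h) => // n.
  by rewrite add0r.
rewrite scale0r addr0 => abc0; exists 1, a; split=> //.
  by apply: contraNneq abc0 => ->.
by apply: eq_symbol x => n; rewrite mulr1.
Qed.

End Symbols.

(** * Comparison with the normal forms *)

Lemma sl2_decomp (K : fieldType) (m : sl2 K) :
  m = m 0 1 *: e_plus + m 1 0 *: e_minus + m 0 0 *: e_zero.
Proof.
have tr : m 1 1 = - m 0 0.
  apply/eqP; rewrite -addr_eq0 addrC.
  have /eqP := sl2_tr m; rewrite /mxtrace !big_ord_recl big_ord0 addr0 => E.
  by apply/eqP; rewrite -{}[RHS]E; congr (_ + sl2_mx m _ _); apply/val_inj.
have I2 (i : 'I_2) : i = 0 \/ i = 1.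
  by case: i => [[|[|]]] // ?; [left|right]; apply/val_inj.
apply/val_inj/matrixP => i j /=.
by case: (I2 i) => ->; case: (I2 j) => ->; rewrite !mxE /= ?tr; ring.
Qed.

(** Each normal form sends some nilpotent matrix to a multiple of [q^2] or of
    [p], and a bracket with such an element lowers the degree in the other
    generator. *)
Lemma normal_form_ad_nilpotent (K : numFieldType) (f : sl2 K -> weyl K) :
  normal_forms f -> exists2 m, m != 0 & forall a, ad_nilpotent (f m) a.
Proof.
case=> [->|[b _ <-]].
- exists e_plus => [|a].
    by apply/eqP => /(congr1 (fun m : sl2 K => m 0 1))/eqP; rewrite !mxE oner_eq0.
  rewrite /f_I; have [-> _ _] := sl2_linE (- (2^-1 *: weyl_q ^+ 2))
    (2^-1 *: weyl_p ^+ 2) (2^-1 *: (weyl_p * weyl_q + weyl_q * weyl_p) : weyl K).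
  by rewrite -scaleNr; apply: ad_nilpotent_q2.
- exists e_minus => [|a].
    by apply/eqP => /(congr1 (fun m : sl2 K => m 1 0))/eqP; rewrite !mxE oner_eq0.
  rewrite /f_II; have [_ -> _] := sl2_linE ((b%:A + weyl_p * weyl_q) * weyl_q)
    (- weyl_p) (2 *: (weyl_p * weyl_q) + b%:A).
  exact: ad_nilpotent_p.
Qed.

Unset Implicit Arguments.

Theorem proposition6p13 (R : realType) (g : sl2 R[i] -> weyl R[i])
    (hg : realisation g)
    (g_plus : g e_plus = (1 + weyl_p * weyl_q) * weyl_q)
    (g_minus : g e_minus =
       - weyl_p + 4 *: (weyl_p ^+ 2 * weyl_q ^+ 3)
       - 4 *: (weyl_p ^+ 3 * weyl_q ^+ 6) + 12 *: (weyl_p ^+ 2 * weyl_q ^+ 5))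
    (g_zero : g e_zero =
       2 *: (weyl_p * weyl_q) - 4 *: (weyl_p ^+ 2 * weyl_q ^+ 4) + 1) :
  ~ normalisable g.
Proof.
move=> [_ [alpha [w /normal_form_ad_nilpotent[m0 m0n0 nil]]]].
set m := sl2_aut_inv w m0; have m_n0 : m != 0.
  by apply: contraNneq m0n0 => m0E; rewrite -(sl2_aut_invK w m0) -/m m0E linear0.
have [lin_g _ _] := hg.
have gm : g m = m 0 1 *: g e_plus + m 1 0 *: g e_minus + m 0 0 *: g e_zero.
  pose G := GRing.isLinear.Build _ _ _ _ g lin_g.
  pose g' : {linear sl2 R[i] -> weyl R[i]} := HB.pack g G.
  by rewrite {1}[m]sl2_decomp -[g]/(g' : _ -> _) !linearD !linearZ.
have m_coef : (m 0 1, m 1 0, m 0 0) != 0.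
  apply: contraNneq m_n0 => -[m01 m10 m00].
  by rewrite [m]sl2_decomp m01 m10 m00 !scale0r !addr0.
have [r [c [r0 c0 symb]]] := symbol_realisation_g m_coef.
apply: (symbol_not_ad_nilpotent c0 r0 symb).
rewrite -g_plus -g_minus -g_zero -gm.
have [k adk] := nil (alpha weyl_q); exists k.
apply: (bij_inj (weyl_aut_bij alpha)); rewrite linear0 -adk.
exact: rmorph_iter_ad.
Qed.
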